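(* Let $n\ge 3$. There exist exactly $$\begin{bmatrix}n\\ n-3\end{bmatrix}_2\cdot\left(2^{3(n-3)}-7\left(2^{n-3}-1\right)-1\right)$$ distinct elementary abelian regular subgroups $\mathcal{T}\le\mathrm{AGL}(V)$ such that $\dim(W(\mathcal{T}))=n-3$.
   Context: $V=(\mathbb{F}_2)^n$. $T=\{\sigma_a\mid a\in V\}$, where $\sigma_a:x\mapsto x+a$, is the translation group, and $\mathrm{AGL}(V)=\mathrm{GL}(V)\ltimes T$. For an elementary abelian regular subgroup $\mathcal{T}\le\mathrm{AGL}(V)$ (regular in its action on $V$), $W(\mathcal{T})=\{a\in V\mid\sigma_a\in\mathcal{T}\}$, a subspace of $V$. $\begin{bmatrix}n\\ d\end{bmatrix}_2=\prod_{i=0}^{d-1}\frac{2^{n-i}-1}{2^{d-i}-1}$ is the Gaussian binomial (equal to $1$ for $d=0$). *)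

(* Defs.v *)
From mathcomp Require Import all_boot all_order all_algebra all_fingroup.
From mathcomp Require Import all_solvable.

Set Implicit Arguments.
Unset Strict Implicit.
Unset Printing Implicit Defensive.

Import GRing.Theory.
Local Open Scope ring_scope.

Notation V n := 'rV['F_2]_n.

Lemma sigma_inj n (a : V n) : injective (fun x : V n => x + a).
Proof. exact: addIr. Qed.

Definition sigma n (a : V n) : {perm V n} := perm (sigma_inj (a := a)).

Lemma sigmaE n (a x : V n) : sigma a x = x + a.
Proof. by rewrite permE. Qed.

Lemma sigma0 n : sigma (0 : V n) = 1%g.
Proof. by apply/permP=> x; rewrite sigmaE addr0 perm1. Qed.

Lemma sigmaD n (a b : V n) : sigma (a + b) = (sigma a * sigma b)%g.
Proof. by apply/permP=> x; rewrite permM !sigmaE addrA. Qed.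

Definition translations n : {set {perm V n}} := [set sigma a | a : V n].

Lemma translations_group_set n : group_set (translations n).
Proof.
apply/group_setP; split; first by rewrite -sigma0 imset_f.
by move=> _ _ /imsetP[a _ ->] /imsetP[b _ ->]; rewrite -sigmaD imset_f.
Qed.

Canonical translations_group n := Group (translations_group_set n).

Definition GL n : {set {perm V n}} :=
  [set s : {perm V n} | [forall c : 'F_2, forall x : V n, forall y : V n,
              s (c *: x + y) == c *: s x + s y]].

Lemma GLP n (s : {perm V n}) : reflect (linear s) (s \in GL n).
Proof.
rewrite inE; apply: (iffP forallP) => [lin c x y | lin c].
  by have /forallP/(_ x)/forallP/(_ y)/eqP := lin c.
by apply/forallP=> x; apply/forallP=> y; rewrite lin.
Qed.

Lemma GL_group_set n : group_set (GL n).
Proof.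
apply/group_setP; split; first by apply/GLP=> c x y; rewrite !perm1.
by move=> s t /GLP ls /GLP lt; apply/GLP=> c x y; rewrite !permM ls lt.
Qed.

Canonical GL_group n := Group (GL_group_set n).

Definition AGL n : {set {perm V n}} := (translations n <*> GL n)%g.

Canonical AGL_group n := [group of AGL n]%G.

Lemma GL0 n (s : {perm V n}) : s \in GL n -> s 0 = 0.
Proof.
by move/GLP/(_ (-1) 0 0); rewrite !scaleN1r oppr0 addr0 addNr.
Qed.

Lemma sdprod_AGL n : (translations n ><| GL n = AGL n)%g.
Proof.
apply: sdprodEY.
  apply/subsetP=> s sGL; rewrite inE; apply/subsetP=> t.
  case/imsetP=> _ /imsetP[a _ ->] ->{t}.
  apply/imsetP; exists (s a) => //; apply/permP=> x.
  rewrite conjgE !permM !sigmaE.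
  have := GLP _ sGL 1 (s^-1 x)%g a; rewrite !scale1r => ->.
  by rewrite permKV.
apply/trivgP/subsetP=> _ /setIP[/imsetP[a _ ->]] /GL0.
by rewrite sigmaE add0r => ->; rewrite sigma0 inE.
Qed.

Lemma AGLP n (s : {perm V n}) :
  reflect (exists2 g, g \in GL n & exists b, forall x, s x = g x + b)
          (s \in AGL n).
Proof.
rewrite -(sdprodWC (sdprod_AGL n)).
apply: (iffP mulsgP) => [[g _ gGL /imsetP[b _ ->] ->] | [g gGL [b sE]]].
  by exists g => //; exists b => x; rewrite permM sigmaE.
exists g (sigma b) => //; first exact: imset_f.
by apply/permP=> x; rewrite sE permM sigmaE.
Qed.

Definition regular n (G : {set {perm V n}}) : bool :=
  [transitive G, on [set: V n] | 'P] && [forall x : V n, 'C_G[x | 'P]%g == 1%g].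

Definition W n (G : {set {perm V n}}) : {vspace V n} :=
  <<enum [set a : V n | sigma a \in G]>>%VS.

(* For a subgroup, the span adds nothing. *)
Lemma mem_W n (G : {group {perm V n}}) (a : V n) :
  (a \in W G) = (sigma a \in G).
Proof.
apply/idP/idP=> [aW | aG]; last by apply: memv_span; rewrite mem_enum inE.
rewrite (coord_span (X := in_tuple _) aW).
elim/big_ind: _ => [|x y xG yG|i _]; first by rewrite sigma0 group1.
  by rewrite sigmaD groupM.
have : (in_tuple (enum [set a : V n | sigma a \in G]))`_i
         \in enum [set a : V n | sigma a \in G] by apply: mem_nth.
rewrite mem_enum inE; set v := _`_i; move: (coord _ _ _) => c vG.
have [->|->] : c = 0 \/ c = 1.
  by case: c => [[|[|//]] lt]; [left | right]; apply: val_inj.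
- by rewrite scale0r sigma0 group1.
- by rewrite scale1r.
Qed.

Definition gauss_binom2 (n d : nat) : rat :=
  \prod_(i < d) ((2 ^+ (n - i) - 1) / (2 ^+ (d - i) - 1)).

(* Main.v *)
Require Import Defs.
From mathcomp Require Import all_boot all_order all_algebra all_fingroup.
From mathcomp Require Import all_solvable.
From HB Require Import structures.
From mathcomp Require Import finfield ring zify.

Set Implicit Arguments.
Unset Strict Implicit.
Unset Printing Implicit Defensive.

Import GRing.Theory.
Local Open Scope ring_scope.

(** An elementary abelian regular subgroup G of AGL(V) is the same thing as a
commutative associative bilinear product on V with x * x = 0: the element of G
sending 0 to a is x |-> x + a + x * a.  Affinity makes the product additive in
x, commutativity of G makes it commutative, exponent 2 makes it alternating,
and closure of G under composition is associativity ([group_circ_set] and the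
section AlgebraToGroup).  Under this correspondence W(G) is the annihilator of
the product ([reg_mul_W]).

Let the annihilator U have codimension 3.  If some x * (y * z) were nonzero,
then x, y, z and x * y would be linearly independent modulo U, which is
impossible; so the product takes its values in U ([codim3_nil]), and conversely
associativity is automatic for products that factor through V / U and take
their values in U.  An alternating bilinear map out of the 3-dimensional space
V / U is the cross product followed by a linear map C from F_2^3 to U
([alternating_cross]), and such a C is arbitrary except that the annihilator
must not exceed U.  A vector u of F_2^3 is annihilated exactly when C has the
form u^T r ([cross_kernel]), so what must be avoided is C of rank at most 1.
With d = dim U there are 2^(3d) maps C in all; over F_2 a rank-one matrix
determines its two factors, hence 1 + 7 (2^d - 1) maps have rank at most 1.
This gives the number of groups G with W(G) = U ([card_fibre]).

It remains to multiply by the number of subspaces U of dimension n - 3.  This is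
done by counting the pairs formed of a group G and an ordered basis of W(G) in
two ways ([abelem_regular_double_count]), since the number of bases of a space
and the number of free families of V are both products of the same shape
([card_free_tuples]), whose quotient is the Gaussian binomial
([gauss_binom2E]). *)

(** * Bases of subspaces over a finite field *)

Lemma card_rV_vspace (F : finFieldType) n (U : {vspace 'rV[F]_n}) :
  #|[set x | x \in U]| = (#|F| ^ \dim U)%N.
Proof. by rewrite cardsE; exact: (card_vspace (T := 'rV[F]_n)). Qed.

(** A free d-tuple in U extends to a free (d+1)-tuple of U by prepending any
vector of U outside its span, and that span has q^d elements. *)
Lemma card_free_tuples (F : finFieldType) n (U : {vspace 'rV[F]_n}) d :
  #|[set t : d.-tuple 'rV[F]_n | free t && all [in U] t]|
  = (\prod_(i < d) (#|F| ^ \dim U - #|F| ^ i))%N.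
Proof.
elim: d => [|d IHd].
  rewrite big_ord0; apply/eqP/cards1P; exists [tuple].
  by apply/setP => t; rewrite !inE tuple0 /= nil_free eqxx.
rewrite big_ord_recr /= -IHd.
pose E := [set p : d.-tuple 'rV[F]_n * 'rV[F]_n |
  (free p.1 && all [in U] p.1) && ((p.2 \in U) && (p.2 \notin <<p.1>>%VS))].
pose f (p : d.-tuple 'rV[F]_n * 'rV[F]_n) := [tuple of p.2 :: p.1].
have inj_f: injective f.
  by move=> [t v] [t' v'] [-> tt']; congr pair; apply: val_inj.
transitivity #|f @: E|.
  apply: eq_card => t; rewrite inE; apply/idP/imsetP => [|[p pE ->]].
    case/tupleP: t => v t; rewrite /= free_cons => H; exists (t, v) => //.
    by rewrite inE /=; case/andP: H => /andP[-> ->] /andP[-> ->].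
  by rewrite inE in pE; case/andP: pE => /andP[? ?] /andP[? ?];
    rewrite /= free_cons; apply/andP; split; apply/andP; split.
rewrite (card_imset _ inj_f) -sum1dep_card.
rewrite -(pair_big_dep (fun t : d.-tuple 'rV[F]_n => free t && all [in U] t)
  (fun t v => (v \in U) && (v \notin <<t>>%VS)) (fun _ _ => 1%N)) /=.
rewrite -sum_nat_const big_mkcond [RHS]big_mkcond /=; apply: eq_bigr => t _.
rewrite inE; case: ifP => // /andP[tfree tU].
rewrite sum1dep_card -card_rV_vspace.
have -> : (#|F| ^ d = #|[set x | x \in <<t>>%VS]|)%N.
  by rewrite card_rV_vspace; move: tfree; rewrite /free size_tuple => /eqP ->.
rewrite -cardsDS; last first.
  apply/subsetP => x; rewrite !inE; apply: (subvP _); apply/span_subvP => y.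
  exact: (allP tU).
by apply: eq_card => v; rewrite !inE andbC.
Qed.

(** The Gaussian binomial as a quotient of numbers of free families: the i-th
factors of the two products both contain 2^i, which cancels. *)
Lemma gauss_binom2E n d : (d <= n)%N ->
  gauss_binom2 n d * (\prod_(i < d) (2 ^ d - 2 ^ i))%:R
  = (\prod_(i < d) (2 ^ n - 2 ^ i))%:R.
Proof.
move=> dn; rewrite !natr_prod -big_split /=; apply: eq_bigr => i _.
have E k : (i <= k)%N -> (2 ^ k - 2 ^ i)%:R = 2 ^+ i * (2 ^+ (k - i) - 1) :> rat.
  move=> ik; rewrite natrB ?leq_exp2l // !natrX mulrBr mulr1 -exprD.
  by rewrite subnKC.
rewrite !E ?(leq_trans (ltnW (ltn_ord i))) // mulrCA mulfVK //.
  rewrite subr_eq0 -natrX Num.Theory.pnatr_eq1.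
  by rewrite -(expn0 2) eqn_exp2l // subn_eq0 -ltnNge.
Qed.

(** * Coordinates modulo a subspace *)

(** Coordinates on the quotient by U: x *m P lists the coordinates of x along a
complement of U, and the rows of S are the chosen basis of that complement. *)
Lemma complement_coords (F : fieldType) n k (U : {vspace 'rV[F]_n}) :
  (\dim U + k)%N = n ->
  exists P : 'M[F]_(n, k), exists S : 'M[F]_(k, n),
    S *m P = 1%:M /\ forall x, (x \in U) = (x *m P == 0).
Proof.
move=> dimU.
have dimUC : \dim U^C = k.
  rewrite dimv_compl dimvf /dim /= mul1n.
  by move/(congr1 (subn^~ (\dim U))): dimU; rewrite addKn.
have [X Xb] : exists X : k.-tuple 'rV[F]_n, basis_of U^C%VS X.
  by rewrite -dimUC; exists (vbasis U^C); apply: vbasisP.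
pose p (x : 'rV[F]_n) : 'rV[F]_k := \row_j coord X j (x - projv U x).
have lin_p : linear p.
  move=> c x y; apply/rowP => j; rewrite !mxE -linearP (linearP (projv U)).
  by rewrite scalerBr opprD addrACA.
pose pL := HB.pack_for {linear 'rV[F]_n -> 'rV[F]_k} p
  (GRing.isLinear.Build _ _ _ _ _ lin_p).
have pE x : x *m lin1_mx pL = p x by rewrite mul_rV_lin1.
exists (lin1_mx pL), (\matrix_i X`_i); split.
  apply/row_matrixP => i; rewrite row_mul rowK pE row1; apply/rowP => j.
  have: X`_i \in (U^C)%VS by apply: (basis_mem Xb); rewrite mem_nth ?size_tuple.
  rewrite -lker_proj memv_ker => /eqP e.
  by rewrite !mxE e subr0 (coord_free _ _ (basis_free Xb)) eq_sym.
move=> x; rewrite pE; apply/idP/eqP => [xU | p0].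
  by apply/rowP => j; rewrite !mxE projv_id // subrr linear0.
have: x - projv U x = 0.
  rewrite (coord_basis Xb (memv_projC U x)) big1 // => j _.
  by move/rowP/(_ j): p0; rewrite !mxE => ->; rewrite scale0r.
by move/eqP; rewrite subr_eq0 => /eqP ->; apply: memv_proj.
Qed.

(** * The cross product and alternating maps in dimension 3 *)

(** The elements of 'I_3 are written 0, 1 and 1 + 1 because 'I_3 is used as the
integers modulo 3: the cross product is invariant under cyclic shifts of the
coordinates. *)
Lemma ord3_cases (k : 'I_3) : [\/ k = 0, k = 1 | k = 1 + 1].
Proof.
by case: k => [[|[|[|//]]] lt]; [apply: Or31|apply: Or32|apply: Or33]; apply: val_inj.
Qed.

Lemma ord3_add (i := 1 : 'I_3) :
  prod (prod (0 + i = i) (0 + (i + i) = i + i))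
    (prod (prod (i + (i + i) = 0) (i + i + i = 0)) (i + i + (i + i) = i)).
Proof. by do !split; apply: val_inj. Qed.

Lemma sum_ord3 (M : nmodType) (f : 'I_3 -> M) :
  \sum_i f i = f 0 + f 1 + f (1 + 1).
Proof.
rewrite !big_ord_recl big_ord0 addr0 addrA.
by congr (_ + f _ + f _); apply: val_inj.
Qed.

Definition cross (R : comNzRingType) (u v : 'rV[R]_3) : 'rV[R]_3 :=
  \row_k (u 0 (k + 1) * v 0 (k + (1 + 1)) - u 0 (k + (1 + 1)) * v 0 (k + 1)).

Lemma crossC (R : comNzRingType) (u v : 'rV[R]_3) : cross u v = - cross v u.
Proof. by apply/rowP => k; rewrite !mxE; ring. Qed.

Lemma crossvv (R : comNzRingType) (v : 'rV[R]_3) : cross v v = 0.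
Proof. by apply/rowP => k; rewrite !mxE; ring. Qed.

Lemma crossDl (R : comNzRingType) (u v w : 'rV[R]_3) :
  cross (u + v) w = cross u w + cross v w.
Proof. by apply/rowP => k; rewrite !mxE; ring. Qed.

Lemma crossZl (R : comNzRingType) c (u v : 'rV[R]_3) :
  cross (c *: u) v = c *: cross u v.
Proof. by apply/rowP => k; rewrite !mxE; ring. Qed.

(** The mixed product of u, v and u vanishes. *)
Lemma cross_trmx (R : comNzRingType) (u v : 'rV[R]_3) : cross u v *m u^T = 0.
Proof.
apply/matrixP => i j; rewrite !ord1 !mxE sum_ord3 !mxE !ord3_add; ring.
Qed.

Lemma cross_delta (R : comNzRingType) (k : 'I_3) :
  cross (delta_mx 0 (k + 1)) (delta_mx 0 (k + (1 + 1))) = delta_mx 0 k :> 'rV[R]_3.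
Proof.
apply/rowP => j; rewrite !mxE !eqxx /=.
by case: (ord3_cases k) => ->; case: (ord3_cases j) => ->; rewrite !ord3_add /=;
  rewrite ?mul0r ?mulr0 ?mul1r ?subr0 ?sub0r ?oppr0.
Qed.

(** The map cross u _ has a 2-dimensional image, so a matrix that kills this image
has rank at most one.  Testing v on the standard basis gives the minors
u_i C_j = u_j C_i, which say that all rows of C are proportional to u.  The
converse is [cross_trmx]. *)
Lemma cross_kernel (F : fieldType) n (C : 'M[F]_(3, n)) (u : 'rV[F]_3) :
  u != 0 -> (forall v, cross u v *m C = 0) -> exists r : 'rV_n, C = u^T *m r.
Proof.
move=> u0 H.
have E i j : u 0 i *: row j C = u 0 j *: row i C.
  have K k : u 0 (k + 1) *: row (k + (1 + 1)) C = u 0 (k + (1 + 1)) *: row (k + 1) C.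
    have := H (delta_mx 0 k); rewrite mulmx_sum_row sum_ord3 !mxE.
    by case: (ord3_cases k) => ->; rewrite !ord3_add /= ?mulr0 ?mulr1 ?sub0r ?subr0
      ?scale0r ?add0r ?addr0 ?oppr0 ?scale0r ?add0r ?addr0 scaleNr => /eqP;
      rewrite ?(addrC (- _)) subr_eq0 => /eqP.
  by move: (K 0) (K 1) (K (1 + 1)); rewrite !ord3_add;
    case: (ord3_cases i) => ->; case: (ord3_cases j) => ->.
have [i ui] : exists i, u 0 i != 0.
  by apply/rV0Pn.
exists ((u 0 i)^-1 *: row i C); apply/matrixP => j k.
have /rowP/(_ k) := E i j; rewrite !mxE big_ord1 !mxE => Ek.
by apply: (mulfI ui); rewrite Ek mulrCA mulVKf.
Qed.

(** The cross product is the universal alternating map in dimension 3: its values on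
the pairs of consecutive basis vectors are the basis vectors, so b is determined
by its three values on these pairs. *)
Lemma alternating_cross (F : fieldType) n (b : 'rV[F]_3 -> 'rV[F]_3 -> 'rV[F]_n) :
  (forall v, linear (b^~ v)) -> (forall v, linear (b v)) -> (forall v, b v v = 0) ->
  forall u v, b u v = cross u v *m
    \matrix_k b (delta_mx 0 (k + 1)) (delta_mx 0 (k + (1 + 1))).
Proof.
move=> linl linr alt u v.
have DL x y z : b (x + y) z = b x z + b y z by have := linl z 1 x y; rewrite !scale1r.
have DR x y z : b z (x + y) = b z x + b z y by have := linr z 1 x y; rewrite !scale1r.
have L0 z : b 0 z = 0 by have := linl z (-1) 0 0; rewrite !scaleN1r oppr0 addr0 addNr.
have R0 z : b z 0 = 0 by have := linr z (-1) 0 0; rewrite !scaleN1r oppr0 addr0 addNr.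
have ZL c x z : b (c *: x) z = c *: b x z by have := linl z c x 0; rewrite L0 !addr0.
have ZR c x z : b z (c *: x) = c *: b z x by have := linr z c x 0; rewrite R0 !addr0.
have anti x y : b x y = - b y x.
  apply/eqP; rewrite -addr_eq0; have := alt (x + y).
  by rewrite DL !DR !alt add0r addr0 => ->.
rewrite [in LHS](row_sum_delta u) [in LHS](row_sum_delta v) mulmx_sum_row !sum_ord3.
rewrite !rowK !mxE !ord3_add !(DL, DR, ZL, ZR) !alt !scaler0 !add0r !addr0.
rewrite (anti (delta_mx 0 1) (delta_mx 0 0))
  (anti (delta_mx 0 (1 + 1)) (delta_mx 0 1)) (anti (delta_mx 0 0) (delta_mx 0 (1 + 1))).
apply/rowP => j; rewrite !mxE; ring.
Qed.

(** * Vectors and rank-one matrices over the field with two elements *)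

Lemma F2_cases (c : 'F_2) : c = 0 \/ c = 1.
Proof. by case: c => [[|[|//]] lt]; [left | right]; apply: val_inj. Qed.

Lemma addvv n (x : V n) : x + x = 0.
Proof.
apply/matrixP => i j; rewrite !mxE.
by case: (F2_cases (x i j)) => ->; apply: val_inj.
Qed.

Lemma addvv_eq0 n (x y : V n) : (x + y == 0) = (x == y).
Proof. by rewrite -[in LHS](addvv y) (inj_eq (addIr y)). Qed.

Lemma tr_mul_eq0 (F : fieldType) n k (u : 'rV[F]_k) (r : 'rV[F]_n) :
  u != 0 -> (u^T *m r == 0) = (r == 0).
Proof.
case/rV0Pn => i ui; apply/eqP/eqP => [/matrixP e | ->]; last by rewrite mulmx0.
apply/rowP => j; have := e i j; rewrite !mxE big_ord1 !mxE => /eqP.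
by rewrite mulf_eq0 (negPf ui) => /eqP.
Qed.

Lemma F2_neq0 (c : 'F_2) : c != 0 -> c = 1.
Proof. by case: (F2_cases c) => ->. Qed.

(** Over a field the factors of a rank-one matrix are determined up to a scalar; over
F_2 the only nonzero scalar is 1, so they are determined. *)
Lemma tr_mul_inj n k (u u' : 'rV['F_2]_k) (r r' : 'rV['F_2]_n) :
  u != 0 -> u' != 0 -> r != 0 -> r' != 0 ->
  u^T *m r = u'^T *m r' -> (u, r) = (u', r').
Proof.
move=> u0 u'0 r0 r'0 /matrixP E.
have e i j : u 0 i * r 0 j = u' 0 i * r' 0 j.
  by have := E i j; rewrite !mxE !big_ord1 !mxE.
have nz a b : (a * b != 0 :> 'F_2) = (a != 0) && (b != 0) by rewrite mulf_eq0 negb_or.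
have [i ui] := rV0Pn _ u0; have [j rj] := rV0Pn _ r0.
have [u'i r'j] : u' 0 i != 0 /\ r' 0 j != 0.
  by apply/andP; rewrite -nz -e nz ui.
congr pair; apply/rowP => l.
  by have := e l j; rewrite (F2_neq0 rj) (F2_neq0 r'j) !mulr1.
by have := e i l; rewrite (F2_neq0 ui) (F2_neq0 u'i) !mul1r.
Qed.

(** * Regular permutation groups *)

Lemma regular_trans n (G : {group {perm V n}}) :
  regular G -> forall x y, exists2 s, s \in G & s x = y.
Proof.
case/andP => tr _ x y.
have [s sG ->] := atransP2 tr (in_setT x) (in_setT y).
by exists s.
Qed.

Lemma regular_inj n (G : {group {perm V n}}) :
  regular G -> forall s t x, s \in G -> t \in G -> s x = t x -> s = t.
Proof.
case/andP => _ /forallP st s t x sG tG e.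
have: (s * t^-1)%g \in 'C_G[x | 'P]%g.
  rewrite inE groupM ?groupV //; apply/astab1P.
  by rewrite /= apermE permM e permK.
by rewrite (eqP (st x)) inE -eq_mulgV1 => /eqP.
Qed.

Lemma card_regular n (G : {group {perm V n}}) : regular G -> #|G| = (2 ^ n)%N.
Proof.
case/andP => tr /forallP st.
rewrite -(card_orbit_stab 'P G 0) (atransP tr) ?in_setT // (eqP (st 0)) cards1.
by rewrite muln1 cardsT card_mx card_Fp // mul1n.
Qed.

(** Regularity gives G order 2^n, so with n > 0 the prime in is_abelem is 2. *)
Lemma regular_abelemE n (G : {group {perm V n}}) : (0 < n)%N -> regular G ->
  reflect (abelian G /\ forall s, s \in G -> (s * s = 1)%g) (is_abelem G).
Proof.
move=> n0 rG.
rewrite (@is_abelem_pgroup _ 2); last first.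
  by rewrite /pgroup (card_regular rG) pnatX pnat_id.
have e2 (s : {perm V n}) : (s ^+ 2 = s * s)%g by rewrite expgS expg1.
by apply: (iffP (abelemP _)) => // -[abG e]; split=> // s /e; rewrite e2.
Qed.

(** * The product attached to a group *)

(** The unique element of a regular group that sends 0 to a. *)
Definition reg_elt n (G : {set {perm V n}}) (a : V n) : {perm V n} :=
  odflt 1%g [pick s in G | s 0 == a].

(** How far the element of G that sends 0 to a is from the translation by a; in
characteristic 2 the signs do not matter.  It is locked so that rewriting with the
laws of addition does not look inside. *)
Definition reg_mul n (G : {set {perm V n}}) (x a : V n) : V n :=
  locked (reg_elt G a x + x + a).

Section GroupToAlgebra.
Variables (n : nat) (G : {group {perm V n}}).
Hypotheses (GAGL : G \subset AGL n) (abG : abelian G).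
Hypotheses (invG : forall s, s \in G -> (s * s = 1)%g) (regG : regular G).

Local Notation "x *' y" := (reg_mul G x y) (at level 40).

Lemma reg_eltP a : reg_elt G a \in G /\ reg_elt G a 0 = a.
Proof.
rewrite /reg_elt; case: pickP => [s /andP[sG /eqP]|no] //=.
have [s sG e] := regular_trans regG 0 a.
by have := no s; rewrite sG e eqxx.
Qed.

Lemma reg_elt_uniq s : s \in G -> reg_elt G (s 0) = s.
Proof.
by move=> sG; have [tG e] := reg_eltP (s 0); apply: (regular_inj regG tG sG e).
Qed.

Lemma reg_eltE a x : reg_elt G a x = x + a + x *' a.
Proof.
rewrite /reg_mul -!lock -[reg_elt G a x + x + a]addrA (addrCA (x + a)).
by rewrite addvv addr0.
Qed.

(** The linear part of the affine map reg_elt G a is x |-> x + x * a. *)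
Lemma reg_mul_linear a : linear (fun x => x *' a).
Proof.
have [tG e] := reg_eltP a.
have /AGLP[g /GLP gl [b gE]] := subsetP GAGL _ tG.
have g0 : g 0 = 0 by have := gl (-1) 0 0; rewrite !scaleN1r oppr0 addr0 addNr.
have eb : b = a by rewrite -e gE g0 add0r.
have E x : x *' a = g x + x.
  by rewrite /reg_mul -!lock gE eb -addrA [x + a]addrC addrA -(addrA (g x)) addvv addr0.
by move=> c x y; rewrite !E gl scalerDr addrACA.
Qed.

(** Two commuting elements that send 0 to x and to y send 0 to the same vector when
composed in either order, namely to x + y + x * y and to y + x + y * x. *)
Lemma reg_mulC x y : x *' y = y *' x.
Proof.
have [tG e] := reg_eltP x; have [uG f] := reg_eltP y.
have := centsP abG _ tG _ uG => /permP/(_ 0).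
rewrite !permM e f => E; rewrite /reg_mul -!lock E -!addrA; congr (_ + _); exact: addrC.
Qed.

Lemma reg_mulvv x : x *' x = 0.
Proof.
have [tG e] := reg_eltP x.
have /permP/(_ 0) := invG tG; rewrite permM e perm1 => E.
by rewrite /reg_mul -!lock E add0r addvv.
Qed.

Lemma reg_mulDl x y a : (x + y) *' a = x *' a + y *' a.
Proof. by have := reg_mul_linear a 1 x y; rewrite !scale1r. Qed.

Lemma reg_mulDr x y a : a *' (x + y) = a *' x + a *' y.
Proof. by rewrite !(reg_mulC a) reg_mulDl. Qed.

Lemma reg_mul0l a : 0 *' a = 0.
Proof. by have := reg_mul_linear a (-1) 0 0; rewrite !scaleN1r oppr0 addr0 addNr. Qed.

(** The composite of the elements attached to y and z belongs to G and sends 0 to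
y + z + y * z, so it is the element attached to that vector; comparing their
values at x leaves x * (y * z) on one side and (x * y) * z on the other. *)
Lemma reg_mulA x y z : x *' (y *' z) = (x *' y) *' z.
Proof.
have [tG e] := reg_eltP y; have [uG f] := reg_eltP z.
have := reg_elt_uniq (groupM tG uG); rewrite permM e => /permP/(_ x).
rewrite permM !reg_eltE !reg_mulDl !reg_mulDr.
rewrite !addrA [LHS](ACl ((1*2*5*3*6*4)*7)) /=.
exact: addrI.
Qed.

(** A translation is the element attached to a vector whose products all vanish, so
W(G) is the annihilator of the product. *)
Lemma reg_mul_W x : reflect (forall y, y *' x = 0) (x \in W G).
Proof.
have [tG e] := reg_eltP x.
rewrite mem_W; apply: (iffP idP) => [sG y|H].
  have /permP/(_ y) := reg_elt_uniq sG; rewrite !sigmaE add0r reg_eltE.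
  by rewrite -[RHS]addr0; apply: addrI.
suff -> : sigma x = reg_elt G x by [].
by apply/permP => y; rewrite sigmaE reg_eltE H addr0.
Qed.

Lemma mem_reg_elt s : (s \in G) = (s == reg_elt G (s 0)).
Proof.
apply/idP/eqP => [/reg_elt_uniq -> // | ->]; exact: (reg_eltP _).1.
Qed.

End GroupToAlgebra.

(** * The group attached to a product *)

(** The maps x |-> x + a + mul x a.  The vector a is recovered as s 0, which makes
sense of membership without knowing that these maps are bijective. *)
Definition circ_set n (mul : V n -> V n -> V n) : {set {perm V n}} :=
  [set s : {perm V n} | [forall x, s x == x + s 0 + mul x (s 0)]].

Lemma circ_setP n (mul : V n -> V n -> V n) (s : {perm V n}) :
  reflect (forall x, s x = x + s 0 + mul x (s 0)) (s \in circ_set mul).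
Proof. by rewrite inE; apply: (iffP forallP) => H x; apply/eqP. Qed.

Section AlgebraToGroup.
Variables (n : nat) (mul : V n -> V n -> V n).
Hypotheses (mul_lin : forall a, linear (mul^~ a)) (mulC : commutative mul).
Hypotheses (mulA : associative mul) (mulvv : forall x, mul x x = 0).

Let L0 t : mul 0 t = 0.
Proof. by have := mul_lin t (-1) 0 0; rewrite !scaleN1r oppr0 addr0 addNr. Qed.
Let R0 t : mul t 0 = 0. Proof. by rewrite mulC L0. Qed.
Let DL u v t : mul (u + v) t = mul u t + mul v t.
Proof. by have := mul_lin t 1 u v; rewrite !scale1r. Qed.
Let DR u v t : mul t (u + v) = mul t u + mul t v.
Proof. by rewrite mulC DL !(mulC _ t). Qed.
Let sq u v : mul u (mul u v) = 0. Proof. by rewrite mulA mulvv L0. Qed.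

(** Bijectivity comes for free in characteristic 2: applying the map twice leaves
the terms mul a a and mul (mul x a) a, which vanish. *)
Lemma circ_involutive a : involutive (fun x => x + a + mul x a).
Proof.
move=> x; rewrite !DL mulvv addr0 (mulC (mul x a)) (mulC x) sq addr0.
by rewrite [LHS](ACl (1*(2*4)*(3*5))) /= !addvv !addr0.
Qed.

Lemma circ_set_ex a : exists2 s, s \in circ_set mul & s 0 = a.
Proof.
have e0 : perm (inv_inj (circ_involutive a)) 0 = a by rewrite permE L0 add0r addr0.
exists (perm (inv_inj (circ_involutive a))) => //.
by apply/circ_setP => x; rewrite e0 permE.
Qed.

Lemma circ_set_inj s t :
  s \in circ_set mul -> t \in circ_set mul -> s 0 = t 0 -> s = t.
Proof.
by move=> /circ_setP sE /circ_setP tE e; apply/permP => x; rewrite sE tE e.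
Qed.

(** With x o a = x + a + mul x a, closure under composition is the associativity of
this circle operation, which reduces to that of mul. *)
Lemma circ_group_set : group_set (circ_set mul).
Proof.
apply/group_setP; split=> [|s t /circ_setP sE /circ_setP tE].
  by apply/circ_setP => x; rewrite !perm1 R0 !addr0.
apply/circ_setP => x; rewrite !permM (tE (s x)) (tE (s 0)) (sE x).
rewrite !DL !DR mulA.
rewrite !addrA [LHS](ACl (1*2*4*6*3*5*7)) /=.
by [].
Qed.

Let circ1 : 1%g \in circ_set mul.
Proof. by case/group_setP: circ_group_set. Qed.
Let circM s t : s \in circ_set mul -> t \in circ_set mul -> (s * t)%g \in circ_set mul.
Proof. by case/group_setP: circ_group_set => _; apply. Qed.

Lemma circ_set_abelian : abelian (circ_set mul).
Proof.
apply/centsP => s sG t tG.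
apply: circ_set_inj; [exact: circM | exact: circM |].
move/circ_setP: sG => sE; move/circ_setP: tG => tE.
by rewrite !permM (tE (s 0)) (sE (t 0)) mulC [t 0 + _]addrC.
Qed.

Lemma circ_set_invol s : s \in circ_set mul -> (s * s = 1)%g.
Proof.
move=> sG; apply: circ_set_inj; [exact: circM | exact: circ1 |].
by move/circ_setP: sG => sE; rewrite permM sE perm1 mulvv addr0 addvv.
Qed.

Lemma circ_set_AGL : circ_set mul \subset AGL n.
Proof.
apply/subsetP => s /circ_setP sE; apply/AGLP.
have gE x : (s * sigma (s 0))%g x = x + mul x (s 0).
  by rewrite permM sigmaE sE [LHS](ACl ((1*3)*(2*4))) /= addvv addr0.
exists (s * sigma (s 0))%g; last first.
  by exists (s 0) => x; rewrite gE sE addrAC.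
by apply/GLP => c x y; rewrite !gE mul_lin scalerDr addrACA.
Qed.

Lemma circ_set_regular : regular (circ_set mul).
Proof.
apply/andP; split.
  apply/imsetP; exists 0; rewrite ?inE //; apply/setP => x; rewrite inE; symmetry.
  by apply/imsetP; have [s sG e] := circ_set_ex x; exists s; rewrite //= apermE e.
apply/forallP => x; apply/eqP/setP => s.
apply/setIP/set1P => [[sG /astab1P] | ->]; last first.
  by split; [exact: circ1 | apply/astab1P; rewrite /= apermE perm1].
(* If s fixes x then a = x * a for a = s 0, hence a = x * (x * a) = 0. *)
rewrite /= apermE => sx.
apply: circ_set_inj => //.
move/circ_setP: sG => sE.
have: s 0 + mul x (s 0) == 0.
  by rewrite -(inj_eq (addrI x)) addrA -sE sx addr0.
rewrite addvv_eq0 perm1 => /eqP e.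
by have := sq x (s 0); rewrite -!e.
Qed.

Lemma sigma_circ_set a : sigma a \in circ_set mul <-> forall x, mul x a = 0.
Proof.
split=> [/circ_setP H x | H].
  have := H x; rewrite !sigmaE add0r -[LHS]addr0.
  by move/addrI.
by apply/circ_setP => x; rewrite !sigmaE add0r H addr0.
Qed.

End AlgebraToGroup.

Lemma circ_set_mul_inj n (mul mul' : V n -> V n -> V n) :
  (forall a, exists2 s, s \in circ_set mul & s 0 = a) ->
  circ_set mul = circ_set mul' -> mul =2 mul'.
Proof.
move=> ex e x a; have [s sG s0] := ex a.
have sG' := sG; rewrite e in sG'; move/circ_setP: sG => /(_ x).
by move/circ_setP: sG' => ->; rewrite s0 => /addrI.
Qed.

Lemma group_circ_set n (G : {group {perm V n}}) :
  abelian G -> (forall s, s \in G -> (s * s = 1)%g) -> regular G ->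
  G = circ_set (reg_mul G) :> {set _}.
Proof.
move=> abG invG regG; apply/setP => s; apply/idP/circ_setP => [sG x | sE].
  by rewrite -[in LHS](reg_elt_uniq regG sG) reg_eltE.
rewrite (mem_reg_elt regG); apply/eqP/permP => x.
by rewrite reg_eltE -sE.
Qed.

(** * Products whose annihilator has codimension 3 *)

(** A nonzero product of three vectors forces x, y, z and x * y to be independent
modulo the annihilator: multiplying a relation by y * z, x * z, x * y and z in
turn kills all its terms but one, because a repeated factor gives 0.  Four
vectors cannot be independent in a space of dimension 3. *)
Lemma codim3_nil (F : fieldType) n (P : 'M[F]_(n, 3))
    (mul : 'rV[F]_n -> 'rV[F]_n -> 'rV[F]_n) :
    (forall a, linear (mul^~ a)) -> commutative mul -> associative mul ->
    (forall x, mul x x = 0) ->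
    (forall a, a *m P = 0 -> forall x, mul x a = 0) ->
  forall x y z, mul x (mul y z) = 0.
Proof.
move=> lin mulC mulA mulvv ann x y z; apply/eqP/negPn/negP => nz.
set e := mul x (mul y z) in nz.
have L0 t : mul 0 t = 0.
  by have := lin t (-1) 0 0; rewrite !scaleN1r oppr0 addr0 addNr.
have R0 t : mul t 0 = 0 by rewrite mulC L0.
have DL u v t : mul (u + v) t = mul u t + mul v t.
  by have := lin t 1 u v; rewrite !scale1r.
have ZL c u t : mul (c *: u) t = c *: mul u t.
  by have := lin t c u 0; rewrite L0 !addr0.
have sq u v : mul u (mul u v) = 0 by rewrite mulA mulvv L0.
have sq' u v : mul v (mul u v) = 0 by rewrite (mulC u) sq.
pose w (i : 'I_4) := tnth [tuple x; y; z; mul x y] i.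
pose M : 'M[F]_(4, 3) := \matrix_i (w i *m P).
have: kermx M != 0.
  by rewrite kermx_eq0 /row_free ltn_eqF // ltnS rank_leq_col.
case/rowV0Pn => c /sub_kermxP cM; case/negP; apply/eqP.
pose a := \sum_i c 0 i *: w i.
have aP : a *m P = 0.
  rewrite mulmx_suml -[RHS]cM mulmx_sum_row.
  by apply: eq_bigr => i _; rewrite rowK scalemxAl.
(* [c] is a linear relation between the four vectors modulo the annihilator. *)
pose c0 := c 0 0; pose c1 := c 0 1; pose c2 := c 0 (1 + 1); pose c3 := c 0 (1 + 1 + 1).
have aE t : c0 *: mul x t + c1 *: mul y t + c2 *: mul z t + c3 *: mul (mul x y) t = 0.
  have := ann a aP t; rewrite mulC /a !big_ord_recr big_ord0 /= add0r !DL !ZL.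
  rewrite /w !(tnth_nth 0) /= => <-.
  by congr (c _ _ *: _ + c _ _ *: _ + c _ _ *: _ + c _ _ *: _); apply: val_inj.
have zc k : k *: e = 0 -> k = 0.
  by move/eqP; rewrite scaler_eq0 (negPf nz) orbF => /eqP.
have ey : mul y (mul x z) = e by rewrite mulA (mulC y) -mulA.
have ez : mul (mul x y) z = e by rewrite -mulA.
have z0 : c0 = 0.
  apply: zc; have := aE (mul y z).
  by rewrite sq sq' -mulA sq R0 !scaler0 !addr0.
have z1 : c1 = 0.
  apply: zc; have := aE (mul x z).
  by rewrite sq sq' ey (mulC x y) -mulA sq R0 !scaler0 !addr0 add0r.
have z2 : c2 = 0.
  apply: zc; have := aE (mul x y).
  by rewrite sq sq' mulvv (mulC z) ez !scaler0 !addr0 !add0r.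
have z3 : c3 = 0.
  by apply: zc; have := aE z; rewrite z0 z1 z2 ez !scale0r !add0r.
apply/rowP => i; rewrite mxE.
suff: [\/ i = 0, i = 1, i = 1 + 1 | i = 1 + 1 + 1] by case=> ->.
by case: i => [[|[|[|[|//]]]] lt]; [apply: Or41|apply: Or42|apply: Or43|apply: Or44];
  apply: val_inj.
Qed.

Definition cross_mul (F : fieldType) n (P : 'M[F]_(n, 3)) (C : 'M[F]_(3, n)) x y :=
  cross (x *m P) (y *m P) *m C.

Section CrossMul.
Variables (n : nat) (P : 'M['F_2]_(n, 3)) (C : 'M['F_2]_(3, n)).

Lemma cross_mul_linear a : linear ((cross_mul P C)^~ a).
Proof.
move=> c x y; rewrite /cross_mul mulmxDl -scalemxAl crossDl crossZl mulmxDl.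
by rewrite -scalemxAl.
Qed.

Lemma cross_mulC : commutative (cross_mul P C).
Proof.
move=> x y; rewrite /cross_mul crossC mulNmx.
by apply/eqP; rewrite -addvv_eq0 addNr.
Qed.

Lemma cross_mulvv x : cross_mul P C x x = 0.
Proof. by rewrite /cross_mul crossvv mul0mx. Qed.

(** C *m P = 0 says that the values of the product annihilate everything, so both
sides of the associativity law vanish. *)
Lemma cross_mulA : C *m P = 0 -> associative (cross_mul P C).
Proof.
move=> CP.
have nil x y z : cross_mul P C x (cross_mul P C y z) = 0.
  rewrite {1}/cross_mul -(mulmxA _ C) CP mulmx0.
  by rewrite -(scale0r 0) crossC crossZl scale0r oppr0 mul0mx.
by move=> x y z; rewrite (cross_mulC (cross_mul P C x y)) !nil.
Qed.

End CrossMul.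

(** * Groups with a prescribed subspace of translations *)

Section Fibre.
Variables (n m : nat) (U : {vspace V n}) (P : 'M['F_2]_(n, 3)) (S : 'M['F_2]_(3, n)).
Hypotheses (dimU : \dim U = m) (SP : S *m P = 1%:M).
Hypothesis (kerP : forall x, (x \in U) = (x *m P == 0)).

(** The matrices whose rows lie in U, that is, the linear maps from F_2^3 to U. *)
Definition valued_in : {set 'M['F_2]_(3, n)} := [set C | C *m P == 0].
(** The matrices of rank at most one with rows in U; requiring u to be nonzero
loses nothing, since r = 0 already gives the zero matrix. *)
Definition rank_le1_in : {set 'M['F_2]_(3, n)} :=
  [set u^T *m r | u in [set u : 'rV['F_2]_3 | u != 0], r in [set r : V n | r \in U]].

Let cardU : #|[set r : V n | r \in U]| = (2 ^ m)%N.
Proof. by rewrite card_rV_vspace card_Fp // dimU. Qed.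

Lemma card_valued_in : #|valued_in| = (2 ^ (3 * m))%N.
Proof.
pose f (g : {ffun 'I_3 -> V n}) : 'M['F_2]_(3, n) := \matrix_i g i.
have inj_f : injective f.
  by move=> g h e; apply/ffunP => i; rewrite -[g i](rowK g) -[h i](rowK h) -/(f g) e.
rewrite mulnC expnM -cardU -[X in (_ ^ X)%N](card_ord 3) -card_ffun_on.
rewrite -(card_imset _ inj_f); apply: eq_card => C; rewrite inE.
apply/eqP/imsetP => [CP | [g /ffun_onP gU ->]].
  exists [ffun i => row i C].
    apply/ffun_onP => i; rewrite ffunE inE kerP -row_mul CP row0 //.
  by apply/row_matrixP => i; rewrite rowK ffunE.
apply/row_matrixP => i; rewrite row_mul rowK row0; apply/eqP.
by rewrite -kerP; have := gU i; rewrite inE.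
Qed.

(** One zero matrix, and one matrix for each of the 7 nonzero u and each nonzero r
of U, all distinct by [tr_mul_inj]. *)
Lemma card_rank_le1_in : #|rank_le1_in| = (1 + 7 * (2 ^ m - 1))%N.
Proof.
pose A := [set u : 'rV['F_2]_3 | u != 0].
pose B := [set r : V n | r \in U] :\ 0.
pose f (p : 'rV['F_2]_3 * V n) := p.1^T *m p.2.
have -> : rank_le1_in = 0 |: f @: setX A B.
  apply/setP => C; rewrite in_setU1; apply/imset2P/orP => [[u r uA rU ->] | ].
    have [-> | r0] := eqVneq r 0; first by left; rewrite mulmx0.
    by right; apply/imsetP; exists (u, r) => //; rewrite in_setX uA in_setD1 r0.
  case=> [/eqP -> | /imsetP[[u r] /setXP[uA /setD1P[_ rU]] ->]].
    exists (const_mx 1) 0; rewrite ?inE ?mem0v ?mulmx0 //.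
    by apply/rV0Pn; exists 0; rewrite mxE.
  by exists u r.
rewrite cardsU1; congr addn.
  case: imsetP => // -[[u r] /setXP[u0 /setD1P[r0 _]] /esym /eqP].
  rewrite inE in u0; by rewrite tr_mul_eq0 //= (negPf r0).
rewrite card_in_imset => [|[u r] [u' r']]; last first.
  move=> /setXP[uA /setD1P[r0 _]] /setXP[u'A /setD1P[r'0 _]].
  by rewrite !inE in uA u'A; apply: tr_mul_inj.
rewrite cardsX; congr muln.
  have -> : A = [set~ 0] by apply/setP => u; rewrite !inE.
  by rewrite cardsC1 card_mx card_Fp.
by rewrite -cardU (cardsD1 0 [set r | r \in U]) inE mem0v /B addnC addnK.
Qed.

Lemma rank_le1_sub : rank_le1_in \subset valued_in.
Proof.
apply/subsetP => C /imset2P[u r _]; rewrite !inE kerP => /eqP rP ->.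
by rewrite -mulmxA rP mulmx0.
Qed.

(** Taking the generated subgroup makes this a group for every C; when the rows of
C lie in U the set is already a group ([cross_groupE]). *)
Definition cross_group C := <<circ_set (cross_mul P C)>>%G.

Lemma cross_groupE C : C \in valued_in -> cross_group C = circ_set (cross_mul P C) :> {set _}.
Proof.
rewrite inE => /eqP CP; apply/gen_set_id; apply: circ_group_set.
- exact: cross_mul_linear.
- exact: cross_mulC.
- exact: cross_mulA.
Qed.

Lemma cross_group_abelem_regular C : (0 < n)%N -> C \in valued_in ->
  [&& cross_group C \subset AGL n, is_abelem (cross_group C) & regular (cross_group C)].
Proof.
move=> n0 CU; have := CU; rewrite inE => /eqP CP.
have lin := @cross_mul_linear n P C; have com := @cross_mulC n P C.
have asc := cross_mulA CP; have alt := @cross_mulvv n P C.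
have rG : regular (cross_group C) by rewrite cross_groupE //; apply: circ_set_regular.
rewrite rG andbT; apply/andP; split; first by rewrite cross_groupE // circ_set_AGL.
by apply/(regular_abelemE n0 rG); rewrite cross_groupE //; split=> [|s];
  [apply: circ_set_abelian | apply: circ_set_invol].
Qed.

(** The annihilator of the product always contains U, and it is larger exactly when
some nonzero u of F_2^3 satisfies cross u v *m C = 0 for all v, which is the
rank condition of [cross_kernel]. *)
Lemma W_cross_group C : C \in valued_in -> (W (cross_group C) == U) = (C \notin rank_le1_in).
Proof.
move=> CU; have := CU; rewrite inE => /eqP CP.
have lin := @cross_mul_linear n P C; have com := @cross_mulC n P C.
have WP a : (a \in W (cross_group C)) <-> forall x, cross_mul P C x a = 0.
  by rewrite mem_W cross_groupE //; apply: sigma_circ_set.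
apply/eqP/negP => [WU | nb].
  case/imset2P => u r; rewrite !inE => u0 rU CE; case/negP: u0.
  have uE : u *m S *m P = u by rewrite -mulmxA SP mulmx1.
  rewrite -[u in u == 0]uE -kerP -WU; apply/WP => x.
  by rewrite /cross_mul uE CE crossC mulmxA mulNmx cross_trmx oppr0 mul0mx.
apply/vspaceP => a; apply/idP/idP => [/WP aW | ]; last first.
  rewrite kerP => /eqP aP; apply/WP => x.
  by rewrite com /cross_mul aP -(scale0r 0) crossZl scale0r mul0mx.
rewrite kerP; apply/negPn/negP => u0; apply: nb.
have [v | r CE] := @cross_kernel _ _ C _ u0.
  by have := aW (v *m S); rewrite com /cross_mul -(mulmxA v) SP mulmx1.
apply/imset2P; exists (a *m P) r; rewrite ?inE //.
by rewrite kerP -(tr_mul_eq0 _ u0) mulmxA -CE CP.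
Qed.

(** The group determines the product, and the product takes on the rows of S the
values that are the rows of C. *)
Lemma cross_group_inj : {in valued_in &, injective cross_group}.
Proof.
move=> C C' CU C'U e.
have E : circ_set (cross_mul P C) = circ_set (cross_mul P C').
  by rewrite -!cross_groupE // e.
have := CU; rewrite inE => /eqP CP.
have {}E : cross_mul P C =2 cross_mul P C'.
  apply: circ_set_mul_inj E => a; apply: circ_set_ex; last exact: cross_mulvv.
  - exact: cross_mul_linear.
  - exact: cross_mulC.
  - exact: cross_mulA.
apply/row_matrixP => k.
have := E (delta_mx 0 (k + 1) *m S) (delta_mx 0 (k + (1 + 1)) *m S).
by rewrite /cross_mul -!(mulmxA _ S) SP !mulmx1 cross_delta !rowE.
Qed.

Lemma cross_group_surj (G : {group {perm V n}}) : (0 < n)%N ->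
  [&& G \subset AGL n, is_abelem G & regular G] -> W G = U ->
  exists2 C, C \in valued_in & G = cross_group C.
Proof.
move=> n0 /and3P[GAGL abelG regG] WU.
have [abG invG] := regular_abelemE n0 regG abelG.
have lin := reg_mul_linear GAGL regG.
have com := reg_mulC abG regG.
have alt := reg_mulvv invG regG.
have ann a : a *m P = 0 -> forall x, reg_mul G x a = 0.
  by move/eqP; rewrite -kerP -WU => /(reg_mul_W regG).
have nil := codim3_nil lin com (reg_mulA GAGL abG regG) alt ann.
have inU x y : reg_mul G x y \in U by rewrite -WU; apply/(reg_mul_W regG) => z; apply: nil.
pose b u v := reg_mul G (u *m S) (v *m S).
have linl v : linear (b^~ v).
  by move=> c x y; rewrite /b mulmxDl -scalemxAl lin.
have bC u v : b u v = b v u by exact: com.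
have linr v : linear (b v).
  by move=> c x y; rewrite !(bC v) linl.
have bE := alternating_cross linl linr (fun v => alt _).
set C := \matrix_k _ in bE.
have CU : C \in valued_in.
  rewrite inE; apply/eqP/row_matrixP => k; rewrite row_mul rowK row0.
  by apply/eqP; rewrite -kerP inU.
exists C => //; apply: val_inj; rewrite /= cross_groupE //.
rewrite (group_circ_set abG invG regG).
suff e : reg_mul G =2 cross_mul P C.
  by apply/setP => s; rewrite !inE; apply: eq_forallb => x; rewrite e.
(* The product depends on x only modulo U, where x agrees with x *m P *m S. *)
have red x a : reg_mul G x a = reg_mul G (x *m P *m S) a.
  apply/eqP; rewrite -addvv_eq0; apply/eqP.
  rewrite -[X in X + _]scale1r -lin scale1r com; apply: ann.
  by rewrite mulmxDl -mulmxA SP mulmx1 addvv.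
by move=> x a; rewrite /cross_mul -bE /b red com red com.
Qed.

Lemma card_fibre : (0 < n)%N ->
  #|[set G : {group {perm V n}} |
     [&& G \subset AGL n, is_abelem G & regular G] && (W G == U)]|
  = (2 ^ (3 * m) - (1 + 7 * (2 ^ m - 1)))%N.
Proof.
move=> n0; rewrite -card_valued_in -card_rank_le1_in.
have /setIidPr e := rank_le1_sub; rewrite -[in X in (_ - X)%N]e -cardsD.
rewrite -(@card_in_imset _ _ cross_group); last first.
  move=> C C' /setDP[CU _] /setDP[C'U _]; exact: cross_group_inj.
apply: eq_card => G; rewrite inE.
apply/andP/imsetP => [[earG /eqP WU] | [C /setDP[CU nb] ->]].
  have [C CU CE] := cross_group_surj n0 earG WU; exists C => //.
  by rewrite in_setD CU andbT -W_cross_group // -CE WU.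
by rewrite W_cross_group // cross_group_abelem_regular.
Qed.

End Fibre.

(** * Counting all the groups *)

(** Both sides count the pairs (G, t) in which t is an ordered basis of W(G): on the
left G is chosen first, on the right t is chosen first among the free m-tuples
of V, and G then ranges over the groups whose subspace W(G) is the span of t. *)
Lemma abelem_regular_double_count n m : (m + 3)%N = n ->
  (#|[set G : {group {perm V n}} |
       [&& G \subset AGL n, is_abelem G, regular G & \dim (W G) == m]]|
    * \prod_(i < m) (2 ^ m - 2 ^ i)
  = \prod_(i < m) (2 ^ n - 2 ^ i) * (2 ^ (3 * m) - (1 + 7 * (2 ^ m - 1))))%N.
Proof.
move=> nE; have n0 : (0 < n)%N by rewrite -nE addnS.
pose ear (G : {group {perm V n}}) := [&& G \subset AGL n, is_abelem G & regular G].
transitivity (\sum_(G : {group {perm V n}} | ear G && (\dim (W G) == m))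
                \sum_(t : m.-tuple (V n) | basis_of (W G) t) 1)%N.
  rewrite -sum_nat_const.
  apply: eq_big => [G | G]; rewrite inE; first by rewrite /ear -!andbA.
  case/and4P=> _ _ _ /eqP dimW; rewrite sum1dep_card.
  transitivity #|[set t : m.-tuple (V n) | free t && all [in W G] t]|.
    by rewrite card_free_tuples card_Fp // dimW.
  apply: eq_card => t; rewrite !inE basisEfree size_tuple dimW leqnn andbT.
  by congr (_ && _); apply/allP/span_subvP.
rewrite (exchange_big_dep (fun t : m.-tuple (V n) => free t)) /=; last first.
  by move=> G t _ /basis_free.
transitivity (\sum_(t in [set t : m.-tuple (V n) | free t])
               (2 ^ (3 * m) - (1 + 7 * (2 ^ m - 1))))%N.
  apply: eq_big => [t | t tfree]; rewrite ?inE // sum1dep_card.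
  have dimU : \dim <<t>> = m by move: tfree; rewrite /free size_tuple => /eqP.
  have [P [S [SP kerP]]] : exists P : 'M['F_2]_(n, 3), exists S : 'M['F_2]_(3, n),
      S *m P = 1%:M /\ forall x, (x \in <<t>>%VS) = (x *m P == 0).
    by apply: complement_coords; rewrite dimU.
  rewrite -(card_fibre dimU SP kerP n0); apply: eq_card => G; rewrite !inE.
  rewrite /basis_of tfree andbT [<<t>>%VS == _]eq_sym -/(ear G) -andbA; congr (_ && _).
  by apply: andb_idl => /eqP ->; rewrite dimU.
rewrite sum_nat_const; congr muln.
transitivity #|[set t : m.-tuple (V n) | free t && all [in fullv] t]|.
  apply: eq_card => t; rewrite !inE; symmetry; apply: andb_idr => _.
  by apply/allP => x _; apply: memvf.
by rewrite card_free_tuples card_Fp // dimvf /dim /= mul1n.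
Qed.

Theorem corollary4p8 (n : nat) (n_ge3 : (3 <= n)%N) :
  #|[set G : {group {perm V n}} |
       [&& G \subset AGL n, is_abelem G, regular G & \dim (W G) == (n - 3)%N]]|%:R
  = gauss_binom2 n (n - 3)
    * (2 ^+ (3 * (n - 3)) - 7 * (2 ^+ (n - 3) - 1) - 1) :> rat.
Proof.
set m := (n - 3)%N; set k := #|_|.
have count : (k * _ = _)%N := abelem_regular_double_count (subnK n_ge3).
rewrite -/m in count.
have nz : (\prod_(i < m) (2 ^ m - 2 ^ i))%:R != 0 :> rat.
  rewrite Num.Theory.pnatr_eq0 -lt0n prodn_gt0 // => i.
  by rewrite subn_gt0 ltn_exp2l.
apply: (mulIf nz); rewrite -natrM count natrM -(gauss_binom2E (leq_subr 3 n)).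
rewrite [RHS]mulrAC; congr (_ * _).
have p1 : (0 < 2 ^ m)%N by rewrite expn_gt0.
rewrite natrB; last first.
  (* With q + 1 = 2^m the subtraction is exact, as 1 + 7 q <= (q + 1)^3. *)
  rewrite (mulnC 3) expnM -(prednK p1) subn1.
  by case: (2 ^ m).-1 => // q; rewrite !expnS expn0 muln1; nia.
by rewrite natrD natrM natrB // !natrX opprD addrA addrAC.
Qed.
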